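(* For every $X\in\mathbb{M}_n$, the elliptical width $\delta_2(X)$ of the numerical range of $X$ satisfies $$ \delta_2(X)\ge 2\|X\|_{\infty}-\big\|\,|X|+|X^*|\,\big\|_{\infty}. $$
   Context: $\mathbb{M}_n$ is the space of $n\times n$ complex matrices, viewed as operators on $\mathbb{C}^n$; $\|\cdot\|_\infty$ is the operator norm; $|T|=(T^*T)^{1/2}$. $W(X)=\{h^*Xh : h\in\mathbb{C}^n,\ \|h\|=1\}$ is the numerical range of $X$, a compact convex subset of $\mathbb{C}$. For a compact convex set $\Lambda\subset\mathbb{C}$, its indiameter $\delta(\Lambda)$ is the diameter of the largest possible disc contained in $\Lambda$ (so it is $0$ if $\Lambda$ is a point or a line segment), and $\delta(X):=\delta(W(X))$. For a subspace $\mathcal{S}\subset\mathbb{C}^n$, $X_{\mathcal{S}}$ denotes the compression of $X$ onto $\mathcal{S}$ (the operator $P X|_{\mathcal{S}}$ on $\mathcal{S}$, with $P$ the orthogonal projection onto $\mathcal{S}$). The elliptical width is $$\delta_2(X):=\sup_{\dim\mathcal{S}=2}\delta(X_{\mathcal{S}}),$$ the supremum being over all two-dimensional subspaces $\mathcal{S}$ of $\mathbb{C}^n$; if $n=1$ it is read as $0$. *)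

(* Defs.v *)
From mathcomp Require Import all_boot all_order all_algebra spectral.
From mathcomp Require Import complex.
From mathcomp Require Import boolp classical_sets reals.

Set Implicit Arguments.
Unset Strict Implicit.
Unset Printing Implicit Defensive.

Import Order.TTheory GRing.Theory Num.Theory.
Local Open Scope classical_set_scope.
Local Open Scope ring_scope.
Local Open Scope complex_scope.
Local Open Scope sesquilinear_scope.

Section EllipticalWidth.
(* The complex field is R[i], for an arbitrary model R of the reals. *)
Context {R : realType}.
Local Notation C := (R[i]).

Section Operators.
Context {n : nat}.
Implicit Types (h k : 'cV[C]_n) (A X : 'M[C]_n) (S : {vspace 'cV[C]_n}).

(* Conjugate-linear in the first argument. *)
Definition inner h k : C := (h^t* *m k) 0 0.

Definition vnorm h : R := Num.sqrt (complex.Re (inner h h)).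

Definition opnorm A : R :=
  sup [set vnorm (A *m h) | h in [set h | vnorm h = 1]].

Definition psdmx A : Prop := A^t* = A /\ forall h, 0 <= inner h (A *m h).

(* The square root of a positive semidefinite matrix, by functional calculus on
   the spectral decomposition A = U^t* *m diag_mx (spectral_diag A) *m U, with
   U = spectralmx A unitary. See sqrtmxP. *)
Definition sqrtmx A : 'M[C]_n :=
  (spectralmx A)^t* *m diag_mx (map_mx sqrtC (spectral_diag A))
    *m spectralmx A.

Definition absmx A : 'M[C]_n := sqrtmx (A^t* *m A).

(* proj_ortho is the orthogonal projection onto a row space, acting on row
   vectors from the right, hence the transpositions. See orthoprojP. *)
Definition orthoproj S : 'M[C]_n :=
  (proj_ortho (\matrix_(i < \dim S) ((vbasis S)`_i)^T))^T.

(* Only the values on S are meaningful. *)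
Definition compression X S h : 'cV[C]_n := orthoproj S *m (X *m h).

(* The numerical range of an operator T on the Hilbert space S. *)
Definition numrange S (T : 'cV[C]_n -> 'cV[C]_n) : set C :=
  [set inner h (T h) | h in [set h | h \in S /\ vnorm h = 1]].

End Operators.

Definition disc (c : C) (r : R) : set C := [set z | `|z - c| <= r%:C].

(* Radius 0 is allowed, so a nonempty L without interior has indiameter 0. *)
Definition indiameter (L : set C) : R :=
  sup [set 2 * r | r in [set r : R | 0 <= r /\ exists c, disc c r `<=` L]].

(* For n <= 1 there is no subspace of dimension 2, and sup set0 = 0. *)
Definition elliptical_width n (X : 'M[C]_n) : R :=
  sup [set indiameter (numrange S (compression X S))
      | S in [set S : {vspace 'cV[C]_n} | \dim S = 2%N]].

Section Facts.
Context {n : nat}.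
Implicit Types (h k : 'cV[C]_n) (A B T : 'M[C]_n) (S : {vspace 'cV[C]_n}).

Lemma trmxC_mul m p q (A : 'M[C]_(m, p)) (B : 'M[C]_(p, q)) :
  (A *m B)^t* = B^t* *m A^t*.
Proof. by rewrite trmx_mul map_mxM. Qed.

Lemma inner_ge0 h : 0 <= inner h h.
Proof.
rewrite /inner mxE sumr_ge0 // => i _.
by rewrite !mxE mulrC mul_conjC_ge0.
Qed.

Lemma innerMl A h k : inner (A *m h) k = inner h (A^t* *m k).
Proof. by rewrite /inner trmxC_mul mulmxA. Qed.

Lemma psdmx_normal A : psdmx A -> A \is normalmx.
Proof. by case=> hA _; apply/normalmxP; rewrite hA. Qed.

Lemma psdmx_gram T : psdmx (T^t* *m T).
Proof.
split; first by rewrite trmxC_mul trmxCK.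
by by move=> h; rewrite -mulmxA -innerMl inner_ge0.
Qed.

Lemma inner_diag (d : 'rV[C]_n) h :
  inner h (diag_mx d *m h) = \sum_i d 0 i * `|h i 0| ^+ 2.
Proof.
rewrite /inner mxE; apply: eq_bigr => i _.
by rewrite mul_diag_mx !mxE normCK mulrCA [_^* * _]mulrC.
Qed.

Lemma psdmx_spectral A i : psdmx A -> 0 <= spectral_diag A 0 i.
Proof.
move=> pA; set U := spectralmx A; set d := spectral_diag A.
have UU : U *m U^t* = 1%:M by apply/unitarymxP/spectral_unitarymx.
have /orthomx_spectralP : A \is normalmx by exact: psdmx_normal.
rewrite -/U -/d invmx_unitary ?spectral_unitarymx // => eA.
have := pA.2 (U^t* *m delta_mx i 0); rewrite innerMl trmxCK [in X in X -> _]eA.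
rewrite -!mulmxA ![U *m (U^t* *m _)]mulmxA UU !mul1mx.
rewrite inner_diag (bigD1 i) //= big1 => [|j /negPf ji].
  by rewrite !mxE !eqxx normr1 expr1n mulr1 addr0.
by rewrite !mxE ji /= normr0 expr0n mulr0.
Qed.

Lemma sqrtmxP A : psdmx A -> psdmx (sqrtmx A) /\ sqrtmx A *m sqrtmx A = A.
Proof.
move=> pA; rewrite /sqrtmx; set U := spectralmx A.
set d := spectral_diag A; set D := diag_mx _.
have UU : U *m U^t* = 1%:M by apply/unitarymxP/spectral_unitarymx.
have /orthomx_spectralP : A \is normalmx by exact: psdmx_normal.
rewrite -/U -/d invmx_unitary ?spectral_unitarymx // => eA.
have sd_ge0 i : 0 <= map_mx sqrtC d 0 i.
  by rewrite mxE sqrtC_ge0 psdmx_spectral.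
split; first split.
- rewrite !trmxC_mul trmxCK -mulmxA; congr (_ *m (_ *m _)).
  rewrite /D tr_diag_mx; apply/matrixP => i j; rewrite !mxE.
  case: eqP => [_|_]; last by rewrite !mulr0n conjC0.
  rewrite !mulr1n; apply/conj_Creal/ger0_real.
  by rewrite sqrtC_ge0 psdmx_spectral.
- move=> h; rewrite -!mulmxA -[U^t* in X in 0 <= X]trmxCK.
  rewrite trmxCK -innerMl inner_diag sumr_ge0 // => i _.
  by rewrite mulr_ge0 ?exprn_ge0.
- rewrite -!mulmxA [U *m (U^t* *m _)]mulmxA UU mul1mx [in RHS]eA -!mulmxA.
  congr (_ *m _); rewrite !mulmxA; congr (_ *m _).
  rewrite mulmx_diag; congr diag_mx; apply/rowP => i.
  by rewrite !mxE -expr2 sqrtCK.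
Qed.

Lemma orthoprojP S h :
  orthoproj S *m h \in S /\
  (forall k, k \in S -> inner k (h - orthoproj S *m h) = 0).
Proof.
rewrite /orthoproj; set V := \matrix_(i < _) _.
have memV u : (u^T <= V)%MS -> u \in S.
  move=> /submxP[a /(congr1 trmx)]; rewrite trmxK => ->.
  rewrite -[_^T]trmxK trmxK mulmx_sum_row linear_sum memv_suml // => i _.
  by rewrite linearZ /= rowK trmxK memvZ // vbasis_mem // mem_nth // size_tuple.
have Vmem u : u \in S -> (u^T <= V)%MS.
  move=> /coord_vbasis ->; rewrite linear_sum summx_sub // => i _.
  rewrite linearZ /= scalemx_sub // (_ : (_)^T = row i V) ?row_sub //.
  by rewrite rowK.
split; first by apply: memV; rewrite trmx_mul trmxK proj_ortho_sub.
move=> k /Vmem kV; rewrite /inner.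
have /orthomx1P : (h^T - h^T *m proj_ortho V <=
    orthomx Num.conj (mx_of_hermitian (hermitian1mx _)) k^T)%MS.
  apply: submx_trans (proj_ortho_compl_sub _ _) _.
  by rewrite submx_ortho.
move=> /(congr1 trmx); rewrite trmx_mul trmx0 map_trmx trmxK.
rewrite linearB /= trmx_mul !trmxK => e.
by rewrite -map_trmx in e *; rewrite e mxE.
Qed.

End Facts.
End EllipticalWidth.

(* Main.v *)
(* Write P = |X|, Q = |X^*|, and let h be a unit top eigenvector of P, with
   eigenvalue s >= |X|_oo. Then X h = s mu k with |mu| = 1, |k| = 1 and
   <h, k> = a >= 0, while Q k = s k and X^* k = s mu^* h. If a < 1, choose g, b with k = a h + b g,
   put k' = a g - b h; in the basis (h, g) the compression of X to span(h, g)
   is mu times a rotation of angle arccos a composed with diag(s, t), where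
   mu t = <k', X g>.
   The mixed Schwarz inequality gives 2 |t| <= <g, P g> + <k', Q k'>, and
   evaluating P + Q at h + k then yields
     |P + Q|_oo >= s (1 + a) + |t| (1 - a),
   so the right-hand side of the theorem is at most (1 - a) (s - |t|).
   On the other hand, in the orthonormal basis of span(h, g) rotated by 45
   degrees from the bisector of h and k, the compression has constant diagonal
   and off-diagonal entries al, be; its numerical range is the ellipse
   { al w + be w^* : |w| <= 1/2 } translated by the diagonal, which contains a
   disc of diameter ||al| - |be|| >= b (s - |t|) >= (1 - a) (s - |t|). *)
Require Import Defs.
From mathcomp Require Import all_boot all_order all_algebra.
From mathcomp Require Import complex reals.
From mathcomp Require Import spectral boolp classical_sets ring lra.

Set Implicit Arguments.
Unset Strict Implicit.
Unset Printing Implicit Defensive.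

Import Order.TTheory GRing.Theory Num.Theory.
Local Open Scope classical_set_scope.
Local Open Scope complex_scope.
Local Open Scope sesquilinear_scope.
Local Open Scope ring_scope.

(** * Inner product, positive semidefinite matrices and the mixed Schwarz inequality *)

Section Inner.
Context {R : realType} {n : nat}.
Local Notation C := (R[i]).
Implicit Types (h k u v w x y : 'cV[C]_n) (A P Q X : 'M[C]_n) (z : C).

Lemma innerDr h u v : inner h (u + v) = inner h u + inner h v.
Proof. by rewrite /inner mulmxDr mxE. Qed.

Lemma innerZr h z u : inner h (z *: u) = z * inner h u.
Proof. by rewrite /inner -scalemxAr mxE. Qed.

Lemma inner0r h : inner h 0 = 0.
Proof. by rewrite /inner mulmx0 mxE. Qed.

Lemma innerC h k : inner k h = (inner h k)^*.
Proof.
rewrite /inner !mxE rmorph_sum; apply: eq_bigr => i _.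
by rewrite !mxE rmorphM /= conjCK mulrC.
Qed.

Lemma innerDl h u v : inner (u + v) h = inner u h + inner v h.
Proof. by rewrite innerC innerDr rmorphD /= -!innerC. Qed.

Lemma innerZl h z u : inner (z *: u) h = z^* * inner u h.
Proof. by rewrite innerC innerZr rmorphM /= -innerC. Qed.

Lemma innerNr h u : inner h (- u) = - inner h u.
Proof. by rewrite -scaleN1r innerZr mulN1r. Qed.

Lemma innerNl h u : inner (- u) h = - inner u h.
Proof. by rewrite innerC innerNr rmorphN /= -innerC. Qed.

Lemma innerMr A h k : inner h (A *m k) = inner (A^t* *m h) k.
Proof. by rewrite innerMl trmxCK. Qed.

Lemma inner_eq0 h : (inner h h == 0) = (h == 0).
Proof.
apply/eqP/eqP => [/eqP|->]; last first.
  by rewrite inner0r.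
rewrite /inner mxE psumr_eq0 => [/allP h0|i _]; last first.
  by rewrite !mxE mulrC mul_conjC_ge0.
apply/colP => i; have := h0 i (mem_index_enum _).
by rewrite !mxE /= mulrC mul_conjC_eq0 => /eqP.
Qed.

Lemma vnorm_sqr h : ((vnorm h) ^+ 2)%:C = inner h h.
Proof.
have hh := inner_ge0 h; rewrite /vnorm sqr_sqrtr ?RRe_real ?ger0_real //.
by move: hh; rewrite lecE => /andP[].
Qed.

Lemma vnormC_sqr h : (vnorm h)%:C ^+ 2 = inner h h.
Proof. by rewrite -vnorm_sqr rmorphXn. Qed.

Lemma vnorm_eq1 h : vnorm h = 1 <-> inner h h = 1.
Proof.
rewrite -vnorm_sqr; split=> [->|/(@complexI _ _ 1) /eqP]; first by rewrite expr1n.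
by rewrite sqrf_eq1 => /orP[/eqP //|/eqP h1]; have := sqrtr_ge0 (complex.Re (inner h h));
  rewrite -/(vnorm h) h1 oppr_ge0 ler10.
Qed.

Lemma vnorm_le h (r : R) : 0 <= r -> (vnorm h <= r) = (inner h h <= (r ^+ 2)%:C).
Proof.
by move=> r0; rewrite -vnorm_sqr lecR ler_pXn2r // nnegrE ?sqrtr_ge0.
Qed.

Lemma vnorm_ge0 h : 0 <= vnorm h. Proof. exact: sqrtr_ge0. Qed.

Lemma CauchySchwarz_unit v w : inner v v = 1 -> `|inner v w| ^+ 2 <= inner w w.
Proof.
move=> v1; have := inner_ge0 (w - inner v w *: v).
rewrite !(innerDl, innerDr, innerNl, innerNr, innerZl, innerZr) v1.
rewrite [inner w v]innerC => ge0; rewrite -subr_ge0 normCK.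
by apply: le_trans ge0 _; rewrite le_eqVlt; apply/orP; left; apply/eqP; ring.
Qed.

Lemma psdmxD P Q : psdmx P -> psdmx Q -> psdmx (P + Q).
Proof.
move=> [hP P0] [hQ Q0]; split=> [|h]; first by rewrite linearD map_mxD hP hQ.
by rewrite mulmxDl innerDr addr_ge0.
Qed.

Lemma psdmx_absmx X : psdmx (absmx X).
Proof. exact: (sqrtmxP (psdmx_gram X)).1. Qed.

Lemma absmx_sqr X : absmx X *m absmx X = X^t* *m X.
Proof. exact: (sqrtmxP (psdmx_gram X)).2. Qed.

Lemma psdmx_diag A : psdmx A ->
  exists U (d : 'rV[C]_n), [/\ U *m U^t* = 1%:M, U^t* *m U = 1%:M,
    A = U^t* *m diag_mx d *m U & forall i, 0 <= d 0 i].
Proof.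
move=> pA; exists (spectralmx A), (spectral_diag A).
have UU : spectralmx A *m (spectralmx A)^t* = 1%:M.
  by apply/unitarymxP/spectral_unitarymx.
split=> // [||i]; [exact: mulmx1C | | exact: psdmx_spectral].
have /orthomx_spectralP : A \is normalmx by exact: psdmx_normal.
by rewrite invmx_unitary ?spectral_unitarymx.
Qed.

(** For z > 0, the vector w = Q y - z y satisfies (Q + z) w = 0; pairing with w gives two
    nonnegative terms with sum 0, hence w = 0. For z = 0, |Q y|^2 = <y, Q Q y> = 0. *)
Lemma psdmx_sqr_eigen Q y z : psdmx Q -> 0 <= z ->
  Q *m (Q *m y) = z ^+ 2 *: y -> Q *m y = z *: y.
Proof.
move=> [hQ Q0]; rewrite le_eqVlt => /predU1P[<-|z0] Qy.
  apply/eqP; rewrite scale0r -inner_eq0 innerMl hQ Qy expr0n scale0r.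
  by rewrite inner0r.
apply/eqP; rewrite -subr_eq0; set w := _ - _.
have : inner w (Q *m w + z *: w) = 0.
  suff -> : Q *m w + z *: w = 0.
    by rewrite inner0r.
  rewrite /w mulmxBr Qy -scalemxAr scalerBr scalerA -expr2.
  by rewrite subrKA subrr.
rewrite innerDr innerZr => /eqP.
rewrite paddr_eq0 ?mulr_ge0 ?inner_ge0 ?(ltW z0) // => /andP[_].
by rewrite mulf_eq0 gt_eqF //= inner_eq0.
Qed.

(** On an eigenbasis c of P, Q^2 acts by the squared eigenvalues of P, so by [psdmx_sqr_eigen] Q
    acts there as P does. *)
Lemma psdmx_sqr_inj P Q : psdmx P -> psdmx Q -> P *m P = Q *m Q -> P = Q.
Proof.
move=> pP pQ PQ; have [U [d [UU UU' eP d0]]] := psdmx_diag pP.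
pose c i : 'cV[C]_n := U^t* *m delta_mx i 0.
have Pc i : P *m c i = d 0 i *: c i.
  rewrite eP /c -!mulmxA [U *m _]mulmxA UU mul1mx scalemxAr; congr (_ *m _).
  by apply/colP => j; rewrite mul_diag_mx !mxE; case: eqP => [->|]; rewrite ?mulr0.
have Qc i : Q *m c i = d 0 i *: c i.
  apply: psdmx_sqr_eigen => //.
  by rewrite mulmxA -PQ -mulmxA !Pc -scalemxAr Pc scalerA expr2.
rewrite -[P]mulmx1 -[Q]mulmx1 -UU' !mulmxA; congr (_ *m _).
apply/matrixP => i j; have := Pc j; rewrite -Qc /c !mulmxA -!colE.
by move=> /colP/(_ i); rewrite !mxE.
Qed.

(** G inverts the eigenvalues of P; the convention 0^-1 = 0 makes it a pseudoinverse when P is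
    singular. *)
Lemma psdmx_pinv P : psdmx P -> exists G, [/\ psdmx G, P *m G = G *m P,
  P *m G *m P = P & G *m P *m G = G].
Proof.
move=> /psdmx_diag[U [d [UU UU' -> d0]]].
pose e := map_mx GRing.inv d; exists (U^t* *m diag_mx e *m U).
have mulUU D E : (U^t* *m diag_mx D *m U) *m (U^t* *m diag_mx E *m U) =
    U^t* *m diag_mx (\row_j (D 0 j * E 0 j)) *m U.
  by rewrite -!mulmxA [U *m (U^t* *m _)]mulmxA UU mul1mx -mulmx_diag !mulmxA.
split; rewrite ?mulUU.
- split.
    rewrite !trmxC_mul trmxCK -mulmxA; congr (_ *m (_ *m _)).
    rewrite tr_diag_mx map_diag_mx; congr diag_mx; apply/rowP => i; rewrite !mxE.
    by apply/conj_Creal/ger0_real; rewrite invr_ge0.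
  move=> h; rewrite -!mulmxA innerMr trmxCK inner_diag sumr_ge0 // => i _.
  by rewrite mulr_ge0 ?exprn_ge0 // mxE invr_ge0.
- by congr (_ *m diag_mx _ *m _); apply/rowP => i; rewrite !mxE mulrC.
- congr (_ *m diag_mx _ *m _); apply/rowP => i; rewrite !mxE.
  by have [->|?] := eqVneq (d 0 i) 0; rewrite ?mulr0 // mulfV ?mul1r.
- congr (_ *m diag_mx _ *m _); apply/rowP => i; rewrite !mxE.
  by have [->|?] := eqVneq (d 0 i) 0; rewrite ?mulr0 ?invr0 ?mul0r // mulVf ?mul1r.
Qed.

Lemma absmx_inner X v :
  inner (X *m v) (X *m v) = inner (absmx X *m v) (absmx X *m v).
Proof.
have := absmx_sqr X; have := (psdmx_absmx X).1.
move: (absmx X) => P hP PP; rewrite !innerMl hP !mulmxA; congr inner.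
by rewrite PP.
Qed.

(* Completing the square: with G the pseudoinverse of |X|, one has
   |X^*| = X G X^*, and the difference of the two sides is the value of |X|
   at x - G X^* y. *)
Lemma mixed_schwarz_re X x y :
  inner y (X *m x) + (inner y (X *m x))^* <=
  inner x (absmx X *m x) + inner y (absmx (X^t*) *m y).
Proof.
have := psdmx_absmx X; have := absmx_sqr X; have := absmx_inner X.
have := psdmx_absmx (X^t*); have := absmx_sqr (X^t*).
move: (absmx X) (absmx _) => P Q QQ pQ XP PP pP.
have [G [pG PG PGP GPG]] := psdmx_pinv pP.
(* |X u| = |P u| for every u; applied to u = (G P - 1) v, which P kills. *)
have XGP : X *m G *m P = X.
  apply/eqP; rewrite -subr_eq0; apply/eqP/matrixP => i j.
  pose v : 'cV[C]_n := delta_mx j 0.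
  have e : (X *m G *m P - X) *m v = X *m ((G *m P - 1%:M) *m v).
    by rewrite mulmxA mulmxBr mulmx1 mulmxA.
  suff /eqP/colP/(_ i) : (X *m G *m P - X) *m v == 0 by rewrite -colE !mxE.
  rewrite -inner_eq0 e XP mulmxA mulmxBr mulmxA PGP mulmx1 subrr.
  by rewrite mul0mx inner0r.
have hP : P^t* = P := pP.1.
have hG : G^t* = G := pG.1.
(* The right-hand side is positive semidefinite with square X X^*, so uniqueness of the square root
   applies. *)
have QE : Q = X *m G *m X^t*.
  apply: psdmx_sqr_inj => //.
    split; first by rewrite !trmxC_mul trmxCK hG mulmxA.
    by move=> h; rewrite -!mulmxA innerMr; apply: pG.2.
  rewrite QQ trmxCK !mulmxA; congr (_ *m _).
  rewrite -[X *m G *m X^t* *m X]mulmxA -PP mulmxA XGP.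
  by rewrite -mulmxA PG mulmxA XGP.
have PGX : P *m G *m X^t* = X^t* by rewrite -[in RHS]XGP !trmxC_mul hP hG mulmxA.
rewrite -subr_ge0; have := pP.2 (x - G *m (X^t* *m y)).
rewrite !mulmxBr !mulmxA PGX !(innerDl, innerDr, innerNl, innerNr).
rewrite QE -!mulmxA.
have -> : inner x (X^t* *m y) = (inner y (X *m x))^* by rewrite -innerC innerMl.
have -> : inner (G *m (X^t* *m y)) (P *m x) = inner y (X *m x).
  by rewrite innerMl innerMl trmxCK hG !mulmxA XGP.
have -> : inner (G *m (X^t* *m y)) (X^t* *m y) = inner y (X *m (G *m (X^t* *m y))).
  by rewrite innerMl innerMl trmxCK hG.
move=> ge0; apply: le_trans ge0 _; rewrite le_eqVlt; apply/orP; left; apply/eqP.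
ring.
Qed.

(** Multiplying y by the phase w of <y, X x> makes that inner product equal to its modulus and
    leaves the right-hand side unchanged. *)
Lemma mixed_schwarz X x y :
  `|inner y (X *m x)| *+ 2 <= inner x (absmx X *m x) + inner y (absmx (X^t*) *m y).
Proof.
set c := inner y (X *m x).
have [c0|c0] := eqVneq c 0.
  rewrite c0 normr0 mul0rn.
  by rewrite addr_ge0 // (psdmx_absmx _).2.
pose w := c / `|c|.
have ww : w^* * w = 1.
  rewrite mulrC -normCK normrM normfV normr_id mulfV ?expr1n //.
  by rewrite normr_eq0.
have := mixed_schwarz_re X x (w *: y).
rewrite -scalemxAr !innerZl !innerZr mulrA ww mul1r -/c.
have -> : w^* * c = `|c|.
  rewrite /w rmorphM /= fmorphV /= (conj_Creal (normr_real _)).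
  by rewrite mulrAC [_ * c]mulrC -normCK expr2 mulfK // normr_eq0.
by rewrite (conj_Creal (normr_real _)) mulr2n.
Qed.

Lemma absmx_top X : (0 < n)%N -> exists s h,
  [/\ 0 <= s, inner h h = 1, absmx X *m h = s%:C *: h &
      forall v, inner v v = 1 -> vnorm (X *m v) <= s].
Proof.
move=> n_gt0; have := psdmx_absmx X; have := absmx_inner X.
move: (absmx X) => P XP pP.
have [U [d [UU UU' eP d0]]] := psdmx_diag pP.
have dr i : (complex.Re (d 0 i))%:C = d 0 i by rewrite RRe_real ?ger0_real.
(* Real parts are maximised because the order on the complex numbers is only partial; [n_gt0]
   supplies an index. *)
have [i _ imax] := arg_maxP (fun i => complex.Re (d 0 i)) (i0 := Ordinal n_gt0) (P := xpredT) isT.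
exists (complex.Re (d 0 i)), (U^t* *m delta_mx i 0).
have s0 : 0 <= complex.Re (d 0 i) by rewrite -lecR dr.
split=> //.
- rewrite innerMl trmxCK mulmxA UU mul1mx /inner mxE (bigD1 i) //= big1 => [|j ji].
    by rewrite !mxE !eqxx conjC1 mulr1 addr0.
  by rewrite !mxE (negPf ji) mulr0.
- rewrite eP -!mulmxA [U *m _]mulmxA UU mul1mx dr scalemxAr; congr (_ *m _).
  by apply/colP => j; rewrite mul_diag_mx !mxE; case: eqP => [->|]; rewrite ?mulr0.
- move=> v v1; rewrite vnorm_le // XP eP -!mulmxA innerMl trmxCK.
  rewrite [U *m (U^t* *m _)]mulmxA UU mul1mx.
  set y := U *m v.
  have y1 : inner y y = 1 by rewrite innerMl mulmxA UU' mul1mx.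
  rewrite -[X in _ <= X]mulr1 -y1 /inner !mxE mulr_sumr ler_sum // => j _.
  rewrite mul_diag_mx !mxE rmorphM /= (conj_Creal (ger0_real (d0 j))).
  rewrite mulrACA ler_wpM2r ?[_^* * _]mulrC ?mul_conjC_ge0 // -expr2 -dr -rmorphXn.
  rewrite lecR ler_pXn2r ?nnegrE //; first exact: imax.
  by rewrite -lecR dr.
Qed.
End Inner.

(** * The operator norm as a genuine supremum *)

Section Opnorm.
Context {R : realType} {n : nat}.
Local Notation C := (R[i]).
Implicit Types (u v : 'cV[C]_n) (M X : 'M[C]_n).

Lemma opnorm_le X (s : R) : (0 < n)%N ->
  (forall v, inner v v = 1 -> vnorm (X *m v) <= s) -> opnorm X <= s.
Proof.
(* Here h only witnesses that the unit sphere is nonempty. *)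
move=> n_gt0 Xs; have [_ [h [_ h1 _ _]]] := absmx_top X n_gt0.
apply: ge_sup => [|_ [v /= /vnorm_eq1/Xs vs <-]//].
by exists (vnorm (X *m h)), h => //; apply/vnorm_eq1.
Qed.

Lemma vnorm_le_opnorm X v : (0 < n)%N -> inner v v = 1 ->
  vnorm (X *m v) <= opnorm X.
Proof.
move=> n_gt0 v1; have [s [_ [_ _ _ Xs]]] := absmx_top X n_gt0.
apply: ub_le_sup; last by exists v => //; apply/vnorm_eq1.
by exists s => _ [u /= /vnorm_eq1/Xs us <-].
Qed.

Lemma inner_le_vnorm X v : inner v v = 1 ->
  `|inner v (X *m v)| <= (vnorm (X *m v))%:C.
Proof.
move=> v1; rewrite -(@ler_pXn2r _ 2) ?nnegrE ?normr_ge0 ?lecR ?vnorm_ge0 //.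
by rewrite vnormC_sqr CauchySchwarz_unit.
Qed.

Lemma psdmx_le_opnorm M v : (0 < n)%N -> psdmx M ->
  inner v (M *m v) <= (opnorm M)%:C * inner v v.
Proof.
move=> n_gt0 [_ M0]; have [->|v0] := eqVneq v 0.
  by rewrite mulmx0 inner0r mulr0.
have vv0 : 0 < inner v v by rewrite lt_def inner_eq0 v0 inner_ge0.
have vn0 : 0 < vnorm v.
  rewrite lt_def vnorm_ge0 andbT; apply: contraTneq vv0.
  by rewrite -vnorm_sqr => ->; rewrite expr0n ltxx.
have cn0 : (vnorm v)%:C != 0 by rewrite -[0](rmorph0 (real_complex R)) (inj_eq (@complexI _)) gt_eqF.
pose w := (vnorm v)%:C^-1 *: v.
have vw : v = (vnorm v)%:C *: w by rewrite scalerA mulfV ?scale1r.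
have cJ : ((vnorm v)%:C)^* = (vnorm v)%:C by rewrite conj_Creal // ger0_real // lecR vnorm_ge0.
have w1 : inner w w = 1.
  rewrite /w innerZl innerZr fmorphV /= cJ -vnormC_sqr.
  by rewrite mulrA -expr2 -exprMn mulVf // expr1n.
clearbody w; move: (vnorm v) vn0 cJ vw => r r0 cJ ->.
rewrite -scalemxAr !innerZl !innerZr w1 mulr1 cJ mulrA -expr2 [leLHS]mulrC.
rewrite ler_wpM2r ?exprn_ge0 ?lecR ?(ltW r0) //.
rewrite (le_trans (real_ler_norm (ger0_real (M0 _)))) //.
by rewrite (le_trans (inner_le_vnorm _ w1)) // lecR vnorm_le_opnorm.
Qed.

End Opnorm.

(** Neither nonemptiness nor boundedness is assumed: [sup] is 0 by default when there is no
    supremum. *)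
Lemma sup_ge0 {R : realType} (E : set R) : (forall x, E x -> 0 <= x) -> 0 <= sup E.
Proof.
move=> E0; have [[[x Ex] ubE]|nE] := pselect (has_sup E); last by rewrite sup_out.
exact: le_trans (E0 _ Ex) (ub_le_sup ubE _).
Qed.

Lemma sup_le_ge0 {R : realType} (E : set R) x : 0 <= x -> ubound E x -> sup E <= x.
Proof.
move=> x0 ubx; have [E0|/set0P/negP/negPn/eqP ->] := pselect (E !=set0); last by rewrite sup0.
exact: ge_sup.
Qed.

(** * Scalar estimates: discs inside ellipses *)

Section Ellipse.
Context {R : realType}.
Local Notation C := (R[i]).

Lemma ge0_ReK (z : C) : 0 <= z -> (complex.Re z)%:C = z.
Proof. by move=> z0; rewrite RRe_real ?ger0_real. Qed.

Lemma norm_is_realC (z : C) : exists2 x, 0 <= x & `|z| = x%:C.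
Proof.
exists (complex.Re `|z|); last by rewrite ge0_ReK.
by rewrite -lecR ge0_ReK normr_ge0.
Qed.

Lemma real_complex_eq0 (x : R) : (x%:C == 0) = (x == 0).
Proof. by rewrite -[0](rmorph0 (real_complex R)) (inj_eq (@complexI _)). Qed.

Lemma conj_realC (x : R) : x%:C^* = x%:C.
Proof. by rewrite -[RHS]conjc_real. Qed.

Lemma norm_realC (x : R) : `|x%:C| = `|x|%:C.
Proof.
case: (ger0P x) => x0; first by rewrite ger0_norm ?lecR.
by rewrite ltr0_norm ?rmorphN ?ltcR.
Qed.

Lemma real_complex_half (x : R) : (x / 2)%:C = x%:C / 2.
Proof. by rewrite rmorphM fmorphV rmorph_nat. Qed.

(** The equation and its conjugate form a linear system in w and w^* with determinant x^2 - y^2. Its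
    solution has modulus at most (x + y) r / |x^2 - y^2| = r / |x - y| <= 1/2. *)
Lemma ellipse_disc (al be z : C) (r x y : R) : 0 < r ->
  `|al| = x%:C -> `|be| = y%:C -> 2 * r <= `|x - y| -> `|z| <= r%:C ->
  exists2 w, `|w| <= 2^-1 & al * w + be * w^* = z.
Proof.
move=> r0 alx bey xy zr.
have x0 : 0 <= x by rewrite -lecR -alx normr_ge0.
have y0 : 0 <= y by rewrite -lecR -bey normr_ge0.
have xDy : 0 < x + y.
  have : 0 < `|x - y| by lra.
  by rewrite normr_gt0 lt_def addr_ge0 // andbT; apply: contraNneq => xy0; apply/eqP; lra.
have D0 : (x ^+ 2 - y ^+ 2)%:C != 0.
  by rewrite real_complex_eq0 subr_sqr mulf_neq0 ?(gt_eqF xDy) // -normr_gt0; lra.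
exists ((al^* * z - be * z^*) / (x ^+ 2 - y ^+ 2)%:C).
  rewrite normf_div ler_pdivrMr ?normr_gt0 //.
  rewrite (le_trans (ler_normB _ _)) // !normrM !norm_conjC alx bey -mulrDl.
  rewrite subr_sqr rmorphM normrM mulrCA -rmorphD /= [leRHS]mulrC.
rewrite !norm_realC -(rmorph_nat (real_complex R)) -fmorphV.
rewrite (le_trans (ler_wpM2l _ zr)) ?lecR ?(ltW xDy) // -!rmorphM /= lecR (gtr0_norm xDy).
by rewrite [2^-1 * _]mulrC -mulrA ler_pM2l //; lra.
rewrite rmorphM /= fmorphV /= conj_realC; move: D0; set D := _%:C => D0.
rewrite rmorphB /= !rmorphM /= !conjCK.
have al2 : al * al^* = (x ^+ 2)%:C by rewrite -normCK alx rmorphXn.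
have be2 : be * be^* = (y ^+ 2)%:C by rewrite -normCK bey rmorphXn.
apply: (mulIf D0); rewrite mulrDl !mulrA !mulfVK //.
by rewrite /D rmorphB /= -al2 -be2; ring.
Qed.

(** With t = p^2, the conditions reduce to t^2 - t + |w|^2 = 0, which has real roots exactly when
    |w| <= 1/2. The larger root is positive, so q = w / p makes sense. *)
Lemma unit_vector_product (w : C) : `|w| <= 2^-1 ->
  exists (p : R) (q : C), p%:C ^+ 2 + `|q| ^+ 2 = 1 /\ p%:C * q = w.
Proof.
have [m m0 wm] := norm_is_realC w; rewrite wm -(rmorph1 (real_complex R)).
rewrite -(rmorph_nat (real_complex R)) -fmorphV lecR => m2.
pose t := (1 + Num.sqrt (1 - 4 * m ^+ 2)) / 2; pose p := Num.sqrt t.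
have t4 : 0 <= 1 - 4 * m ^+ 2 by nra.
have t0 : 0 < t by rewrite /t; have := sqrtr_ge0 (1 - 4 * m ^+ 2); lra.
have p2 : p ^+ 2 = t by rewrite sqr_sqrtr // ltW.
have p0 : p%:C != 0 by rewrite real_complex_eq0 gt_eqF // sqrtr_gt0.
exists p, (w / p%:C); split; last by rewrite mulrC mulfVK.
rewrite normf_div wm norm_realC gtr0_norm ?sqrtr_gt0 // expr_div_n -!rmorphXn /= p2.
rewrite -fmorphV -rmorphM -rmorphD /= -[RHS](rmorph1 (real_complex R)).
congr (_ %:C); have tn0 : t != 0 by rewrite gt_eqF.
apply: (mulIf tn0); rewrite mulrDl mulfVK ?gt_eqF // mul1r.
have := sqr_sqrtr t4; rewrite /t; move: (Num.sqrt _) => a; nra.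
Qed.
(* Expand (x - y)^2: the parallelogram law gives x^2 + y^2, and the product of
   the two numbers is (1 - b^2) (s - t)^2 / 4 - b^2 s t. *)
Lemma ellipse_gap (s b tau nu x y : R) (t : C) : 0 <= s -> 0 <= b <= 1 ->
  `|t| = tau%:C -> `|s%:C - t| = nu%:C ->
  `|(- (s%:C - t) - b%:C * (s%:C + t)) / 2| = x%:C ->
  `|(- (s%:C - t) + b%:C * (s%:C + t)) / 2| = y%:C ->
  (b * (s - tau)) ^+ 2 <= (x - y) ^+ 2.
Proof.
move=> s0 /andP[b0 b1] ht hnu hx hy.
have c2 : (2^-1 : C)^* = 2^-1 by rewrite fmorphV /= conjC_nat.
have e1 : (x * x + y * y) + (x * x + y * y) =
    (1 - b * b) * (nu * nu) + b * b * ((s * s + s * s) + (tau * tau + tau * tau)).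
  have sqrE z w : `|z| = w%:C :> C -> w%:C * w%:C = z * z^* by move=> <-; rewrite -normCK.
  apply: (@complexI R); rewrite !(rmorphD, rmorphB, rmorphM, rmorph1) /=.
  rewrite (sqrE _ _ hx) (sqrE _ _ hy) (sqrE _ _ ht) (sqrE _ _ hnu).
  rewrite !(rmorphD, rmorphB, rmorphM, rmorphN) /= !conj_realC !c2.
  by field.
have e2 : x * y <= (1 - b * b) / 4 * (nu * nu) + b * b * s * tau.
  rewrite -lecR rmorphM /= -hx -hy -normrM.
  rewrite [X in `|X|](_ : _ =
    ((1 - b * b) / 4)%:C * ((s%:C - t) * (s%:C - t)) - (b * b * s)%:C * t).
    rewrite (le_trans (ler_normB _ _)) // !normrM ht hnu !norm_realC.
    rewrite -!rmorphM -rmorphD /= lecR !ger0_norm //; nra.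
  rewrite !(rmorphM, rmorphB, rmorph1, fmorphV) /= -[4]/(4%:R) rmorph_nat.
  by field.
(* In x^2 + y^2 - 2 x y the terms in nu^2 cancel, leaving at least b^2 (s^2 + tau^2 - 2 s tau). *)
nra.
Qed.
End Ellipse.

(** * Lower bounds on the elliptical width from explicit discs *)

Section Indiameter.
Context {R : realType} {n : nat}.
Local Notation C := (R[i]).
Implicit Types (u v : 'cV[C]_n) (X : 'M[C]_n) (S : {vspace 'cV[C]_n}).

Lemma indiameter_ge0 (L : set C) : 0 <= indiameter L.
Proof. by apply: sup_ge0 => _ [r [r0 _] <-]; rewrite mulr_ge0. Qed.

Lemma elliptical_width_ge0 X : 0 <= elliptical_width X.
Proof. by apply: sup_ge0 => _ [S _ <-]; exact: indiameter_ge0. Qed.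

Lemma inner_compression X S v : v \in S ->
  inner v (compression X S v) = inner v (X *m v).
Proof.
move=> vS; have [_ /(_ _ vS)/eqP] := orthoprojP S (X *m v).
by rewrite innerDr innerNr subr_eq0 => /eqP.
Qed.

(** The antipodal points c + r and c - r lie in the numerical range, hence have modulus at most the
    operator norm, and they are 2 r apart. This bounds the suprema defining [indiameter] and
    [elliptical_width]. *)
Lemma disc_numrange_le X S c (r : R) : (0 < n)%N -> 0 <= r ->
  disc c r `<=` numrange S (compression X S) -> r <= opnorm X.
Proof.
move=> n_gt0 r0 sub.
have bnd z : disc c r z -> `|z| <= (opnorm X)%:C.
  move=> /sub[v /= [vS /vnorm_eq1 v1] <-]; rewrite inner_compression //.
  by rewrite (le_trans (inner_le_vnorm _ v1)) // lecR vnorm_le_opnorm.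
have nr : `|r%:C| = r%:C by rewrite ger0_norm ?lecR.
have bp : `|c + r%:C| <= (opnorm X)%:C.
  by apply: bnd; rewrite /disc /= addrAC subrr add0r nr.
have bm : `|c - r%:C| <= (opnorm X)%:C.
  by apply: bnd; rewrite /disc /= addrAC subrr add0r normrN nr.
have := le_trans (ler_normB _ _) (lerD bp bm).
rewrite opprB addrC subrKA -!mulr2n normrMn nr ler_pMn2r //.
by rewrite lecR.
Qed.

Lemma le_elliptical_width X S c (r : R) : (0 < n)%N -> \dim S = 2%N -> 0 <= r ->
  disc c r `<=` numrange S (compression X S) -> 2 * r <= elliptical_width X.
Proof.
move=> n_gt0 dS r0 sub.
have ub S' : ubound [set 2 * r | r in [set r : R | 0 <= r /\
    exists c, disc c r `<=` numrange S' (compression X S')]] (2 * opnorm X).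
  move=> _ [t /= [t0 [d subd]] <-]; rewrite ler_wpM2l //.
  exact: disc_numrange_le subd.
apply: (@le_trans _ _ (indiameter (numrange S (compression X S)))).
  apply: ub_le_sup; first by exists (2 * opnorm X); exact: ub.
  by exists r => //; split=> //; exists c.
apply: ub_le_sup; last by exists S.
exists (2 * opnorm X) => _ [S' _ <-]; apply: sup_le_ge0; last exact: ub.
by rewrite mulr_ge0 // sup_ge0 // => _ [v _ <-]; exact: vnorm_ge0.
Qed.
End Indiameter.

(** * The two-dimensional compression and the norm of the sum *)

Section Width.
Context {R : realType} {n : nat}.
Local Notation C := (R[i]).
Implicit Types (u v h g k : 'cV[C]_n) (X : 'M[C]_n) (S : {vspace 'cV[C]_n}).

Lemma dim_span_orthonormal u v :
  inner u u = 1 -> inner v v = 1 -> inner u v = 0 ->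
  \dim <<[:: u; v]>> = 2%N.
Proof.
move=> u1 v1 uv; apply/eqP.
have v0 : v != 0 by rewrite -inner_eq0 v1 oner_eq0.
rewrite -[2%N]/(size [:: u; v]) -/(free _) free_cons seq1_free v0 andbT.
rewrite span_seq1; apply/negP => /vlineP[z uz]; move/eqP: u1.
by rewrite [X in inner _ X]uz innerZr uv mulr0 eq_sym oner_eq0.
Qed.

(** At a unit vector f = p u + q v with p real, the form of X is the common diagonal value plus al w
    + be w^*, where w = p q. By [unit_vector_product] w runs over the whole disc of radius 1/2, so
    [ellipse_disc] applies. *)
Lemma le_elliptical_width_orthonormal X u v (r x y : R) :
  (0 < n)%N -> 0 < r -> inner u u = 1 -> inner v v = 1 -> inner u v = 0 ->
  inner u (X *m u) = inner v (X *m v) ->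
  `|inner u (X *m v)| = x%:C -> `|inner v (X *m u)| = y%:C ->
  2 * r <= `|x - y| -> 2 * r <= elliptical_width X.
Proof.
move=> n_gt0 r0 u1 v1 uv Xuv alx bey xy.
have vu : inner v u = 0 by rewrite innerC uv conjC0.
apply: (@le_elliptical_width _ _ _ <<[:: u; v]>> (inner u (X *m u))) => //.
- exact: dim_span_orthonormal.
- exact: ltW.
move=> z /= zr; have [w w2 zE] := ellipse_disc r0 alx bey xy zr.
have [p [q [pq1 pqw]]] := unit_vector_product w2.
pose f := p%:C *: u + q *: v.
have fS : f \in <<[:: u; v]>>%VS.
  by rewrite rpredD ?rpredZ // memv_span // !inE eqxx ?orbT.
exists f; first split=> //.
  apply/vnorm_eq1; rewrite !(innerDl, innerDr, innerZl, innerZr) u1 v1 uv vu conj_realC.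
  by move: pq1; rewrite normCK => pq1; rewrite -[RHS]pq1; ring.
rewrite inner_compression // mulmxDr -!scalemxAr.
rewrite !(innerDl, innerDr, innerZl, innerZr) -Xuv conj_realC -[RHS](subrK (inner u (X *m u))).
rewrite -zE -pqw rmorphM /= conj_realC -[X in _ = _ + X]mulr1 -pq1 normCK; ring.
Qed.

Lemma elliptical_width_dilated_rotation X h g (mu t : C) (s a b tau : R) :
  (0 < n)%N -> inner h h = 1 -> inner g g = 1 -> inner h g = 0 ->
  `|mu| = 1 -> `|t| = tau%:C -> 0 <= s -> 0 <= a -> 0 <= b -> a ^+ 2 + b ^+ 2 = 1 ->
  inner h (X *m h) = mu * (s * a)%:C -> inner g (X *m h) = mu * (s * b)%:C ->
  inner h (X *m g) = - (mu * b%:C * t) -> inner g (X *m g) = mu * a%:C * t ->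
  b * (s - tau) <= elliptical_width X.
Proof.
move=> n_gt0 h1 g1 hg mu1 ht s0 a0 b0 ab Xhh Xgh Xhg Xgg.
(* [ellipse_disc] requires a positive radius. *)
have [le0|gt0] := leP (b * (s - tau)) 0; first exact: le_trans le0 (elliptical_width_ge0 X).
have b1 : b <= 1 by nra.
have gh : inner g h = 0 by rewrite innerC hg conjC0.
(* With a = cos phi and b = sin phi, c and d are the cosine and the sine of
   phi / 2 + pi / 4. *)
pose c := Num.sqrt ((1 - b) / 2); pose d := Num.sqrt ((1 + b) / 2).
have c2 : c ^+ 2 = (1 - b) / 2 by rewrite sqr_sqrtr //; lra.
have d2 : d ^+ 2 = (1 + b) / 2 by rewrite sqr_sqrtr //; lra.
have cd : c * d = a / 2.
  rewrite -sqrtrM; last by lra.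
  rewrite [X in Num.sqrt X](_ : _ = (a / 2) ^+ 2); last first.
    by rewrite expr_div_n (_ : a ^+ 2 = 1 - b ^+ 2); [field | lra].
  by rewrite sqrtr_sqr ger0_norm // divr_ge0.
pose u := c%:C *: h + d%:C *: g; pose v := c%:C *: g - d%:C *: h.
(* x and y are the moduli of the off-diagonal entries in the basis (u, v), with the unimodular
   factor mu removed. *)
have [x x0 hx] := norm_is_realC ((- (s%:C - t) - b%:C * (s%:C + t)) / 2).
have [y y0 hy] := norm_is_realC ((- (s%:C - t) + b%:C * (s%:C + t)) / 2).
have [nu _ hnu] := norm_is_realC (s%:C - t).
have gap := ellipse_gap s0 (introT andP (conj b0 b1)) ht hnu hx hy.
have ccC : c%:C * c%:C = (1 - b%:C) / 2.
  by rewrite -rmorphM -expr2 c2 /= real_complex_half rmorphB.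
have ddC : d%:C * d%:C = (1 + b%:C) / 2.
  by rewrite -rmorphM -expr2 d2 /= real_complex_half rmorphD.
have cdC : c%:C * d%:C = a%:C / 2.
  by rewrite -rmorphM cd /= real_complex_half.
have aaC : a%:C * a%:C = 1 - b%:C * b%:C.
  by rewrite -!rmorphM -[1](rmorph1 (real_complex R)) -rmorphB /= -ab; congr (_ %:C); ring.
have uXu : inner u (X *m u) = mu * (a%:C * (s%:C + t) / 2).
  rewrite /u mulmxDr -!scalemxAr !(innerDl, innerDr, innerZl, innerZr) !conj_realC.
  rewrite Xhh Xgh Xhg Xgg !rmorphM /=.
  (* Being square roots, c and d are eliminated only through c^2, c d and d^2, so each entry is
     first regrouped by these products. *)
  rewrite [LHS](_ : _ = (c%:C * c%:C) * (mu * (s%:C * a%:C)) + (c%:C * d%:C) *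
    (mu * (s%:C * b%:C) - mu * b%:C * t) + (d%:C * d%:C) * (mu * a%:C * t)); last by ring.
  by rewrite ccC ddC cdC; field.
have vXv : inner v (X *m v) = mu * (a%:C * (s%:C + t) / 2).
  rewrite /v mulmxBr -!scalemxAr !(innerDl, innerDr, innerNl, innerNr, innerZl, innerZr) !conj_realC.
  rewrite Xhh Xgh Xhg Xgg !rmorphM /=.
  rewrite [LHS](_ : _ = (c%:C * c%:C) * (mu * a%:C * t) - (c%:C * d%:C) *
    (mu * (s%:C * b%:C) - mu * b%:C * t) + (d%:C * d%:C) * (mu * (s%:C * a%:C))); last by ring.
  by rewrite ccC ddC cdC; field.
have uXv : inner u (X *m v) = mu * ((- (s%:C - t) - b%:C * (s%:C + t)) / 2).
  rewrite /u /v mulmxBr -!scalemxAr !(innerDl, innerDr, innerNl, innerNr, innerZl, innerZr) !conj_realC.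
  rewrite Xhh Xgh Xhg Xgg !rmorphM /=.
  rewrite [LHS](_ : _ = - (c%:C * c%:C) * (mu * b%:C * t) + (c%:C * d%:C) *
    (mu * a%:C * t - mu * (s%:C * a%:C)) - (d%:C * d%:C) * (mu * (s%:C * b%:C))); last by ring.
  rewrite ccC ddC cdC.
  rewrite [LHS](_ : _ = mu / 2 * (a%:C * a%:C * (t - s%:C)
    - (1 - b%:C) * b%:C * t - (1 + b%:C) * s%:C * b%:C)); last by field.
  by rewrite aaC; field.
have vXu : inner v (X *m u) = mu * ((- (s%:C - t) + b%:C * (s%:C + t)) / 2).
  rewrite /u /v mulmxDr -!scalemxAr !(innerDl, innerDr, innerNl, innerNr, innerZl, innerZr) !conj_realC.
  rewrite Xhh Xgh Xhg Xgg !rmorphM /=.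
  rewrite [LHS](_ : _ = (c%:C * c%:C) * (mu * (s%:C * b%:C)) + (c%:C * d%:C) *
    (mu * a%:C * t - mu * (s%:C * a%:C)) + (d%:C * d%:C) * (mu * b%:C * t)); last by ring.
  rewrite ccC ddC cdC.
  rewrite [LHS](_ : _ = mu / 2 * (a%:C * a%:C * (t - s%:C)
    + (1 - b%:C) * b%:C * s%:C + (1 + b%:C) * t * b%:C)); last by field.
  by rewrite aaC; field.
have cc_dd : c%:C * c%:C + d%:C * d%:C = 1 by rewrite ccC ddC; field.
have -> : b * (s - tau) = 2 * (b * (s - tau) / 2) by field.
apply: (le_elliptical_width_orthonormal (u := u) (v := v) (x := x) (y := y)) => //.
- by rewrite divr_gt0.
- rewrite !(innerDl, innerDr, innerZl, innerZr) !conj_realC h1 g1 hg gh.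
  by rewrite -[RHS]cc_dd; ring.
- rewrite !(innerDl, innerDr, innerNl, innerNr, innerZl, innerZr) !conj_realC h1 g1 hg gh.
  by rewrite -[RHS]cc_dd; ring.
- rewrite !(innerDl, innerDr, innerNl, innerNr, innerZl, innerZr) !conj_realC h1 g1 hg gh.
  by ring.
- by rewrite uXu vXv.
- by rewrite uXv normrM mu1 mul1r.
- by rewrite vXu normrM mu1 mul1r.
- rewrite mulrC divfK ?pnatr_eq0 // -(@ler_pXn2r _ 2) ?nnegrE ?(ltW gt0) //.
  by rewrite real_normK ?num_real.
Qed.

(** The cross terms vanish: P is Hermitian and h is an eigenvector, so P g stays orthogonal to h. *)
Lemma psdmx_eigen_form P h g (s : C) (p q : R) : psdmx P -> inner h h = 1 -> inner h g = 0 ->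
  P *m h = s *: h ->
  inner (p%:C *: h + q%:C *: g) (P *m (p%:C *: h + q%:C *: g)) =
  s * (p ^+ 2)%:C + (q ^+ 2)%:C * inner g (P *m g).
Proof.
move=> [hP _] h1 hg Ph.
have gh : inner g h = 0 by rewrite innerC hg conjC0.
have hPg : inner h (P *m g) = 0 by rewrite innerMr hP Ph innerZl hg mulr0.
rewrite mulmxDr -!scalemxAr !(innerDl, innerDr, innerZl, innerZr) !conj_realC hPg Ph !innerZr h1 gh.
by rewrite !expr2 !rmorphM /=; ring.
Qed.

(* Lower bound by the value of the form P + Q at the bisector h + k, where
   k = a h + b g and h = a k - b k'. *)
Lemma opnorm_sum_ge P Q h g (s a b tau : R) (k := a%:C *: h + b%:C *: g)
    (k' := a%:C *: g - b%:C *: h) :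
  (0 < n)%N -> psdmx P -> psdmx Q -> inner h h = 1 -> inner g g = 1 -> inner h g = 0 ->
  0 <= a -> a ^+ 2 + b ^+ 2 = 1 -> P *m h = s%:C *: h -> Q *m k = s%:C *: k ->
  (tau *+ 2)%:C <= inner g (P *m g) + inner k' (Q *m k') ->
  s * (1 + a) + tau * (1 - a) <= opnorm (P + Q).
Proof.
move=> n_gt0 pP pQ h1 g1 hg a0 ab Ph Qk tpq.
have gh : inner g h = 0 by rewrite innerC hg conjC0.
have abC : a%:C * a%:C + b%:C * b%:C = 1.
  by rewrite -!rmorphM -rmorphD /= -[1](rmorph1 (real_complex R)) -ab; congr (_ %:C); ring.
have k1 : inner k k = 1.
  rewrite !(innerDl, innerDr, innerZl, innerZr) !conj_realC h1 g1 hg gh.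
  by rewrite -[RHS]abC; ring.
have kk' : inner k k' = 0.
  rewrite !(innerDl, innerDr, innerNr, innerZl, innerZr) !conj_realC h1 g1 hg gh.
  by ring.
have hE : h = a%:C *: k - b%:C *: k'.
  by apply/colP => i; rewrite !mxE -[LHS]mul1r -abC; ring.
have hkP : h + k = (1 + a)%:C *: h + b%:C *: g by rewrite rmorphD scalerDl scale1r addrA.
(* The bisector has the same shape in the pair (k, k') up to the sign of b, which squaring removes;
   so [psdmx_eigen_form] serves both P and Q. *)
have hkQ : h + k = (1 + a)%:C *: k + (- b)%:C *: k'.
  by rewrite rmorphD rmorphN scalerDl scale1r {1}hE scaleNr addrC addrA.
have hk2 : inner (h + k) (h + k) = (2 * (1 + a))%:C.
  rewrite hkP !(innerDl, innerDr, innerZl, innerZr) !conj_realC h1 g1 hg gh.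
  rewrite !(mulr0, mulr1, addr0, add0r) -!rmorphM -rmorphD; congr (_ %:C); nra.
have := psdmx_le_opnorm (h + k) n_gt0 (psdmxD pP pQ).
rewrite hk2 mulmxDl innerDr {1 2}hkP hkQ (psdmx_eigen_form _ _ pP h1 hg Ph) (psdmx_eigen_form _ _ pQ k1 kk' Qk).
rewrite sqrrN addrACA -!mulrDr => le_m.
have : (s * (1 + a) ^+ 2 *+ 2 + b ^+ 2 * (tau *+ 2))%:C <= (opnorm (P + Q) * (2 * (1 + a)))%:C.
  rewrite [leRHS]rmorphM /=; apply: le_trans le_m.
  rewrite rmorphD /=; apply: lerD.
    by rewrite -rmorphD -rmorphM lecR /= mulr2n mulrDr.
  by rewrite rmorphM ler_wpM2l // lecR sqr_ge0.
rewrite lecR => le2; have a1 : 0 < 1 + a by lra.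
rewrite -(ler_pM2r (x := 2 * (1 + a))) ?mulr_gt0 //; apply: le_trans le2.
(* This exposes the factor 2 (1 + a) = |h + k|^2 on both sides. *)
rewrite (_ : b ^+ 2 = (1 - a) * (1 + a)); last by lra.
by rewrite le_eqVlt; apply/orP; left; apply/eqP; ring.
Qed.

End Width.

(** * Construction of h, k, g and conclusion *)

Theorem proposition3p8 (R : realType) (n : nat) (n_gt0 : (0 < n)%N)
    (X : 'M[R[i]]_n) :
  2 * opnorm X - opnorm (absmx X + absmx (map_mx Num.conj X^T))
    <= elliptical_width X.
Proof.
have [s [h [s0 h1 Ph Xs]]] := absmx_top X n_gt0.
have leXs := opnorm_le n_gt0 Xs.
have mixed := mixed_schwarz X.
have := psdmx_absmx X; have := absmx_sqr X.
have := psdmx_absmx (X^t*); have := absmx_sqr (X^t*).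
rewrite -[map_mx _ _]/(X^t*); move: (absmx X) (absmx (X^t*)) Ph mixed => P Q Ph mixed QQ pQ PP pP.
have ew0 := elliptical_width_ge0 X.
have M0 : 0 <= opnorm (P + Q) by apply: sup_ge0 => _ [v _ <-]; exact: vnorm_ge0.
(* If s = 0, the left-hand side of the goal is at most 0; otherwise X h can be divided by s. *)
have [sz|snz] := eqVneq s 0.
  move: leXs M0 ew0; rewrite sz.
  by move: (opnorm X) (opnorm _) (elliptical_width X); clear=> *; lra.
have sC0 : s%:C != 0 by rewrite real_complex_eq0.
have XXh : X^t* *m (X *m h) = s%:C ^+ 2 *: h.
  by rewrite mulmxA -PP -mulmxA Ph -scalemxAr Ph scalerA expr2.
pose k0 := s%:C^-1 *: (X *m h).
have Xh0 : X *m h = s%:C *: k0 by rewrite /k0 scalerA mulfV ?scale1r.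
have k01 : inner k0 k0 = 1.
  rewrite innerZl innerZr fmorphV /= conj_realC innerMl XXh innerZr h1 mulr1.
  by rewrite expr2 mulKf // mulVf.
have [a a0 ha] := norm_is_realC (inner h k0).
(* mu is the phase of <h, k0>, with 1 chosen when that product is 0. *)
have [mu mu1 hmu] : exists2 mu : R[i], `|mu| = 1 & inner h k0 = mu * a%:C.
  have [c0|c0] := eqVneq (inner h k0) 0.
    by exists 1; rewrite ?normr1 // mul1r -ha c0 normr0.
  exists (inner h k0 / `|inner h k0|); last by rewrite -ha divfK // normr_eq0.
  by rewrite normrM normfV normr_id mulfV // normr_eq0.
have mumu : mu * mu^* = 1 by rewrite -normCK mu1 expr1n.
pose k := mu^* *: k0.
have Xh : X *m h = (mu * s%:C) *: k.
  by rewrite scalerA mulrAC mumu mul1r.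
have k1 : inner k k = 1 by rewrite innerZl innerZr conjCK k01 mulr1.
have hk : inner h k = a%:C by rewrite innerZr hmu mulrA [_ * mu]mulrC mumu mul1r.
have XCk : X^t* *m k = (mu^* * s%:C) *: h.
  rewrite -!scalemxAr XXh !scalerA -mulrA.
  by rewrite expr2 mulKf.
have Qk : Q *m k = s%:C *: k.
  apply: psdmx_sqr_eigen => //; first by rewrite lecR.
  rewrite mulmxA QQ trmxCK -mulmxA XCk -scalemxAr Xh scalerA; congr (_ *: _).
  by rewrite mulrACA [mu^* * mu]mulrC mumu mul1r expr2.
clearbody k.
have a1 : a <= 1.
  have := CauchySchwarz_unit k h1; rewrite k1 hk norm_realC -rmorphXn /=.
  by rewrite -[1](rmorph1 (real_complex R)) lecR ger0_norm // expr_le1.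
have kh : inner k h = a%:C by rewrite innerC hk conj_realC.
(* If a = 1, then k = h is a common eigenvector of P and Q, so |P + Q|_oo >= 2 s and the left-hand
   side is at most 0. Otherwise b > 0 and g can be normalised. *)
have [a_eq1|a_neq1] := eqVneq a 1.
  have kE : k = h.
    apply/eqP; rewrite -subr_eq0 -inner_eq0 !(innerDl, innerDr, innerNl, innerNr).
    by rewrite k1 hk kh h1 a_eq1; apply/eqP; ring.
  have Qh : Q *m h = s%:C *: h by rewrite -kE.
  have := psdmx_le_opnorm h n_gt0 (psdmxD pP pQ).
  rewrite mulmxDl Ph Qh innerDr !innerZr h1 !mulr1 -rmorphD lecR.
  by move: leXs ew0; move: (opnorm X) (opnorm _) (elliptical_width X); clear=> *; lra.
pose b := Num.sqrt (1 - a ^+ 2).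
have b2 : b ^+ 2 = 1 - a ^+ 2 by rewrite sqr_sqrtr // subr_ge0 expr_le1.
have b0 : 0 < b by rewrite sqrtr_gt0 subr_gt0 expr_lt1 // lt_neqAle a_neq1.
have bC : b%:C != 0 by rewrite real_complex_eq0 gt_eqF.
have ab : a ^+ 2 + b ^+ 2 = 1 by rewrite b2; ring.
have abC : a%:C * a%:C + b%:C * b%:C = 1.
  by rewrite -!rmorphM -rmorphD /= -[1](rmorph1 (real_complex R)) -ab; congr (_ %:C); ring.
pose g := b%:C^-1 *: (k - a%:C *: h).
have kE : k = a%:C *: h + b%:C *: g by rewrite scalerA mulfV // scale1r addrC subrK.
have hg : inner h g = 0.
  by rewrite innerZr innerDr innerNr innerZr hk h1 mulr1 subrr mulr0.
clearbody g; have gh : inner g h = 0 by rewrite innerC hg conjC0.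
have g1 : inner g g = 1.
  have : inner k k = 1 := k1.
  rewrite kE !(innerDl, innerDr, innerZl, innerZr) !conj_realC h1 hg gh !(mulr0, addr0, add0r) mulr1.
  by rewrite -[RHS]abC mulrA -[X in _ = _ + X]mulr1 => /addrI/(mulfI (mulf_neq0 bC bC)).
pose k' := a%:C *: g - b%:C *: h.
pose t := mu^* * inner k' (X *m g).
have [tau tau0 ht] := norm_is_realC t.
have ht_k' : `|inner k' (X *m g)| = tau%:C by rewrite -ht normrM norm_conjC mu1 mul1r.
have := mixed g k'; rewrite ht_k' -rmorphMn => tpq.
have Qk2 := Qk; rewrite kE in Qk2.
have := opnorm_sum_ge n_gt0 pP pQ h1 g1 hg a0 ab Ph Qk2 tpq.
(* X g has no component along k, so both its entries against h and g come from <k', X g> = mu t. *)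
have kXg : inner k (X *m g) = 0 by rewrite innerMr XCk innerZl hg mulr0.
have Xhg : inner h (X *m g) = - (mu * b%:C * t).
  have -> : h = a%:C *: k - b%:C *: k'.
    by apply/colP => i; rewrite kE !mxE -[LHS]mul1r -abC; ring.
  rewrite innerDl innerNl !innerZl kXg !conj_realC mulr0 add0r /t.
  by rewrite -[LHS]mul1r -mumu; ring.
have Xgg : inner g (X *m g) = mu * a%:C * t.
  have gE : g = b%:C *: k + a%:C *: k'.
    by apply/colP => i; rewrite kE !mxE -[LHS]mul1r -abC; ring.
  rewrite {1}gE innerDl !innerZl kXg !conj_realC mulr0 add0r /t.
  by rewrite -[LHS]mul1r -mumu; ring.
have Xhh : inner h (X *m h) = mu * (s * a)%:C.
  by rewrite Xh innerZr hk rmorphM /= mulrA.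
have Xgh : inner g (X *m h) = mu * (s * b)%:C.
  by rewrite Xh innerZr kE innerDr !innerZr gh g1 rmorphM /=; ring.
have := elliptical_width_dilated_rotation n_gt0 h1 g1 hg mu1 ht s0 a0 (ltW b0) ab Xhh Xgh Xhg Xgg.
move=> ge_ew ge_op.
(* b^2 = (1 - a) (1 + a) >= (1 - a)^2 gives b >= 1 - a, which helps only when s >= tau; otherwise
   the product is at most 0. *)
have : (1 - a) * (s - tau) <= elliptical_width X.
  have [st|/ltW ts] := leP tau s.
    by apply: le_trans ge_ew; rewrite ler_wpM2r ?subr_ge0 //; move: b2 b0 a0 a1; clear=> *; nra.
  by apply: le_trans ew0; rewrite mulr_ge0_le0 ?subr_ge0 ?subr_le0.
by move: leXs ge_op; move: (opnorm X) (opnorm _) (elliptical_width X); clear=> *; lra.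
Qed.
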